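(* Let $(k_n)_{n=1}^\infty$ be a nondecreasing sequence of positive integers such that $k_n\to\infty$ and $k_n=o(n)$. Then, under the measures $\mathbb{P}_{n,k_n}$, $$I\cdot\frac{k_n}{n^2}\longrightarrow \frac12\quad\text{in probability, as } n\to\infty.$$
   Context: For positive integers $k,n$, the $k$-card-minimum ($k$CM) procedure generates a random permutation of $\{1,\dots,n\}$ as follows. Let $D_1=\{1,\dots,n\}$. For $t=1,\dots,n$: given the past, $C_{t,1},\dots,C_{t,k}$ are i.i.d. uniform samples from $D_t$; $C_t=\min\{C_{t,1},\dots,C_{t,k}\}$; and $D_{t+1}=D_t\setminus\{C_t\}$. The resulting permutation is $\sigma=(C_1,\dots,C_n)$. $\mathbb{P}_{n,k}$ denotes the probability measure of this procedure with parameters $n,k$. $I=I(\sigma)=|\{i<j:\sigma(i)>\sigma(j)\}|$ is the number of inversions of $\sigma$. Convergence in probability means $\mathbb{P}_{n,k_n}(|I k_n/n^2-1/2|>\epsilon)\to 0$ as $n \to \infty$ for every $\epsilon>0$. *)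

(* Defs.v *)
From HB Require Import structures.
From mathcomp Require Import all_boot all_order all_algebra all_fingroup.
From mathcomp Require Import all_classical all_reals all_analysis.

Set Implicit Arguments.
Unset Strict Implicit.
Unset Printing Implicit Defensive.

Import Order.TTheory GRing.Theory Num.Theory.
Import numFieldNormedType.Exports.

Local Open Scope ring_scope.

(* The cards 1, ..., n and the times 1, ..., n are both encoded by
   'I_n = {0, ..., n-1}; the shift affects neither minima nor inversions. *)

Definition unif_pmf (R : realType) (n : nat) (D : {set 'I_n}) (x : 'I_n) : R :=
  if x \in D then (#|D|%:R)^-1 else 0.

(* The neutral value n of the iterated minimum exceeds every card, so for
   0 < k it is irrelevant; for k = 0 no card is ever the minimum. *)
Definition min_draw (n k : nat) (c : {ffun 'I_k -> 'I_n}) : nat :=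
  \big[minn/n]_(i < k) (c i : nat).

(* Probability that the minimum of k i.i.d. uniform samples from D is x: the
   joint mass of the samples is summed over all k-tuples of cards whose
   minimum is x. *)
Definition kcm_step (R : realType) (n k : nat) (D : {set 'I_n}) (x : 'I_n) : R :=
  \sum_(c : {ffun 'I_k -> 'I_n} | min_draw c == x)
    \prod_(i < k) unif_pmf R D (c i).

(* The set D_t = {1, ..., n} \ {C_1, ..., C_(t-1)} when (C_1, ..., C_n) = s. *)
Definition remaining (n : nat) (s : {perm 'I_n}) (t : 'I_n) : {set 'I_n} :=
  ~: [set s u | u : 'I_n & (u < t)%N].

(* Chain rule: the mass of s is the product over t of the conditional
   probability that C_t = s t given that C_u = s u for all u < t. *)
Definition kcm_pmf (R : realType) (n k : nat) (s : {perm 'I_n}) : R :=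
  \prod_(t < n) kcm_step R k (remaining s t) (s t).

Definition kcm_prob (R : realType) (n k : nat) (A : {set {perm 'I_n}}) : R :=
  \sum_(s in A) kcm_pmf R k s.

Definition inversions (n : nat) (s : {perm 'I_n}) : nat :=
  #|[set p : 'I_n * 'I_n | (p.1 < p.2)%N & (s p.2 < s p.1)%N]|.

(* Main.v *)
Require Import Defs.
From HB Require Import structures.
From mathcomp Require Import all_boot all_order all_algebra all_fingroup.
From mathcomp Require Import all_classical all_reals all_analysis.
From mathcomp Require Import ring lra.

Import Order.TTheory GRing.Theory Num.Theory.
Import numFieldNormedType.Exports.

Set Implicit Arguments.
Unset Strict Implicit.
Unset Printing Implicit Defensive.

Local Open Scope classical_set_scope.
Local Open Scope ring_scope.

(** The number of inversions is a sum of independent variables, and the theorem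
    is a weak law of large numbers for that sum.

    An inversion whose first entry stands at time [t] is a card that is still
    in the deck [D] and smaller than the card drawn at time [t]. So the
    inversions of [s] are counted by the sum over [t] of the rank of [s t]
    among the remaining cards ([inversions_lehmer]). These ranks form the Lehmer
    code of [s], which determines [s] ([lehmer_inj]). The minimum of [k]
    uniform draws from a deck of [m] cards has rank at least [j] with
    probability [((m - j) / m) ^ k], whatever the deck is ([kcm_stepE] gives the
    corresponding point masses). Hence
    the mass of [s] is the product over [t] of the law [rank_law] at
    the entries of its Lehmer code ([kcm_pmf_lehmer]): under the procedure the
    ranks are independent.

    Since the Lehmer code is injective, the expectation of a nonnegative
    function of the code is at most its integral against the product measure on
    all functions ['I_n -> 'I_n] ([expect_lehmer_le]), so it is enough to bound a
    second moment there. Under the product measure the second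
    moment splits into variances and a squared bias ([second_moment_sum]).

    The mean rank in a deck of [m] cards is the power mean
    [\sum_(i < m) (i / m) ^ k], which lies between [m / (k + 1) - 1] and
    [m / (k + 1)] ([power_mean_bounds]). Summed over the deck sizes and scaled
    by [k / n ^ 2], the mean is within [1 / k + k / n] of [1 / 2]. The rank is
    at most [m], so its second moment is at most [m] times its mean, and each
    variance is at most [n ^ 2 / k]; after scaling, the [n] variances add up to
    at most [k / n]. This crude bound suffices because [k = o(n)]. Chebyshev's
    inequality gives the explicit estimate [kcm_deviation_le], whose right-hand
    side tends to [0]. *)

(** * Second moments under a product measure *)

Section ProductMeasure.
Variables (R : realFieldType) (I J : finType) (p : I -> J -> R).
Hypothesis p_sum1 : forall i, \sum_j p i j = 1.

Let expect (G : {ffun I -> J} -> R) : R :=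
  \sum_(f : {ffun I -> J}) (\prod_i p i (f i)) * G f.

Lemma expect_prod (g : I -> J -> R) :
  expect (fun f => \prod_i g i (f i)) = \prod_i \sum_j p i j * g i j.
Proof.
by rewrite bigA_distr_bigA; apply: eq_bigr => f _; rewrite big_split.
Qed.

Lemma expect_coord (i : I) (g : J -> R) :
  expect (fun f => g (f i)) = \sum_j p i j * g j.
Proof.
have -> : expect (fun f => g (f i)) =
    expect (fun f => \prod_l (if l == i then g (f l) else 1)).
  by apply: eq_bigr => f _; rewrite -big_mkcond big_pred1_eq.
rewrite (expect_prod (fun l y => if l == i then g y else 1)).
rewrite (bigD1 i) //= [X in _ * X]big1 ?mulr1 ?eqxx // => l /negPf ->.
by under eq_bigr do rewrite mulr1.
Qed.

Lemma expect_coord2 (i l : I) (g h : J -> R) : i != l ->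
  expect (fun f => g (f i) * h (f l)) =
    (\sum_j p i j * g j) * (\sum_j p l j * h j).
Proof.
move=> neq_il.
pose gh m y := (if m == i then g y else 1) * (if m == l then h y else 1).
have -> : expect (fun f => g (f i) * h (f l)) =
    expect (fun f => \prod_m gh m (f m)).
  apply: eq_bigr => f _; rewrite big_split /= -!big_mkcond.
  by rewrite !big_pred1_eq.
rewrite expect_prod (bigD1 i) //= (bigD1 l) 1?eq_sym //=.
rewrite [X in _ * (_ * X)]big1 ?mulr1.
  rewrite /gh !eqxx [l == i]eq_sym (negPf neq_il).
  by congr (_ * _); apply: eq_bigr => j _; rewrite ?mulr1 ?mul1r.
move=> m /andP[/negPf nmi /negPf nml]; rewrite /gh nmi nml.
by under eq_bigr do rewrite !mulr1.
Qed.

(** Independence removes the cross terms: only the variances and the square of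
    the bias of the mean remain. *)
Lemma second_moment_sum (X : I -> J -> R) (a : R) :
  let mean i := \sum_j p i j * X i j in
  \sum_(f : {ffun I -> J}) (\prod_i p i (f i)) * (\sum_i X i (f i) - a) ^+ 2 =
    \sum_i \sum_j p i j * (X i j - mean i) ^+ 2 + (\sum_i mean i - a) ^+ 2.
Proof.
move=> mean; pose Y i j := X i j - mean i; pose b := \sum_i mean i - a.
have Y0 i : \sum_j p i j * Y i j = 0.
  under eq_bigr do rewrite mulrBr.
  by rewrite sumrB -mulr_suml p_sum1 mul1r subrr.
have -> : \sum_(f : {ffun I -> J}) (\prod_i p i (f i)) *
      (\sum_i X i (f i) - a) ^+ 2 =
    \sum_(f : {ffun I -> J})
      (\sum_i \sum_l (\prod_i p i (f i)) * (Y i (f i) * Y l (f l)) +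
       (b *+ 2 * (\sum_i (\prod_i p i (f i)) * Y i (f i)) +
        b ^+ 2 * ((\prod_i p i (f i)) * 1))).
  apply: eq_bigr => f _.
  have -> : \sum_i X i (f i) - a = \sum_i Y i (f i) + b.
    by rewrite sumrB /b; ring.
  have -> (w : R) : \sum_i \sum_l w * (Y i (f i) * Y l (f l)) =
      w * (\sum_i Y i (f i)) ^+ 2.
    rewrite expr2 mulr_suml mulr_sumr; apply: eq_bigr => i _.
    by rewrite !mulr_sumr.
  by rewrite -mulr_sumr; ring.
have E1 : \sum_(f : {ffun I -> J}) (\prod_i p i (f i)) * 1 = 1 :> R.
  under eq_bigr do rewrite mulr1.
  by rewrite -bigA_distr_bigA big1.
rewrite !big_split /= -!mulr_sumr E1 mulr1 [X in _ + (_ * X + _)]exchange_big /=.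
rewrite [X in _ + (_ * X + _)]big1 ?mulr0 ?add0r; last first.
  by move=> i _; rewrite -[LHS]/(expect (fun f => Y i (f i))) expect_coord.
congr (_ + _); rewrite exchange_big; apply: eq_bigr => i _ /=.
rewrite exchange_big (bigD1 i) //= [X in _ + X]big1 ?addr0.
  rewrite -[LHS]/(expect (fun f => Y i (f i) * Y i (f i))).
  by rewrite (expect_coord i (fun j => Y i j * Y i j)).
move=> l nli; rewrite -[LHS]/(expect (fun f => Y i (f i) * Y l (f l))).
by rewrite expect_coord2 1?eq_sym // Y0 mul0r.
Qed.

Lemma variance_le_second_moment (i : I) (X : J -> R) :
  \sum_j p i j * (X j - \sum_l p i l * X l) ^+ 2 <= \sum_j p i j * X j ^+ 2.
Proof.
set mu := \sum_l p i l * X l.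
rewrite (_ : \sum_j p i j * _ = \sum_j p i j * X j ^+ 2 - mu ^+ 2).
  by rewrite gerBl sqr_ge0.
transitivity (\sum_j (p i j * X j ^+ 2 - (mu *+ 2) * (p i j * X j) +
    mu ^+ 2 * p i j)).
  by apply: eq_bigr => j _; ring.
by rewrite big_split sumrB /= -!mulr_sumr p_sum1 -/mu; ring.
Qed.

End ProductMeasure.

(** * The rank of the minimum of k uniform draws *)

Section MinimumRank.
Variables (R : realFieldType) (k : nat).

(** Truncated subtraction makes the tail vanish for [m <= j] as soon as [0 < k],
    so that laws for different deck sizes live on a common index range. *)
Definition rank_tail (m j : nat) : R := ((m - j)%:R / m%:R) ^+ k.

Definition rank_law (m j : nat) : R := rank_tail m j - rank_tail m j.+1.

Lemma rank_law_ge0 m j : 0 <= rank_law m j.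
Proof.
rewrite subr_ge0 lerXn2r ?nnegrE ?divr_ge0 //.
by rewrite ler_wpM2r ?invr_ge0 // ler_nat leq_sub2l.
Qed.

Hypothesis k_gt0 : (0 < k)%N.

Lemma rank_tail_eq0 m j : (m <= j)%N -> rank_tail m j = 0.
Proof.
by rewrite -subn_eq0 /rank_tail => /eqP ->; rewrite mul0r expr0n gtn_eqF.
Qed.

Lemma rank_law_sum1 m N : (0 < m <= N)%N -> \sum_(j < N) rank_law m j = 1.
Proof.
case/andP=> m_gt0 le_mN; rewrite -(big_mkord xpredT (rank_law m)).
rewrite (telescope_sumr_eq (fun j => - rank_tail m j)) //; last first.
  by move=> j _; rewrite /rank_law opprK addrC.
rewrite rank_tail_eq0 // /rank_tail subn0 divff ?pnatr_eq0 -?lt0n //.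
by rewrite expr1n opprK oppr0 add0r.
Qed.

(** Summation by parts: the mean of a rank is the sum of its tails, read here in
    reverse order. *)
Lemma rank_mean_tail m N : (m <= N)%N ->
  \sum_(j < N) rank_law m j * j%:R = \sum_(i < m) (i%:R / m%:R) ^+ k.
Proof.
have abel M : \sum_(j < M) rank_law m j * j%:R =
    \sum_(j < M) rank_tail m j.+1 - M%:R * rank_tail m M.
  elim: M => [|M IHM]; first by rewrite !big_ord0 mul0r subrr.
  by rewrite !big_ord_recr /= IHM /rank_law -natr1; ring.
move=> le_mN; rewrite abel rank_tail_eq0 // mulr0 subr0.
rewrite -(subnKC le_mN) big_split_ord /= [X in _ + X]big1 ?addr0; last first.
  by move=> i _; rewrite rank_tail_eq0 // ltnW // ltnS leq_addr.
rewrite (reindex_inj rev_ord_inj); apply: eq_bigr => i _.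
by rewrite /rank_tail /= subnSK // subKn // ltnW.
Qed.

(** The increment factors as a sum of [k + 1] products of [k] factors, each factor
    being [a] or [a + 1]. *)
Lemma exp_increment_bounds (a : nat) :
  k.+1%:R * a%:R ^+ k <=
    (a.+1%:R : R) ^+ k.+1 - a%:R ^+ k.+1 <=
    k.+1%:R * a.+1%:R ^+ k.
Proof.
rewrite subrXX -natrB // subSn // subnn mul1r.
have const (x : R) : k.+1%:R * x = \sum_(i < k.+1) x.
  by rewrite sumr_const card_ord mulr_natl.
rewrite !const; apply/andP; split; apply: ler_sum => i _ /=.
  rewrite -[in leLHS](subnK (leq_ord i)) exprD ler_wpM2r ?exprn_ge0 //.
  by rewrite lerXn2r ?nnegrE // ler_nat.
rewrite -[in leRHS](subnK (leq_ord i)) exprD ler_wpM2l ?exprn_ge0 //.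
by rewrite lerXn2r ?nnegrE // ler_nat.
Qed.

(** Comparison of the sum of [i ^ k] with the telescoping sum of the increments
    of [x ^ (k + 1)], in the role of the integral of [(k + 1) x ^ k]. *)
Lemma power_mean_bounds m : (0 < m)%N ->
  m%:R / k.+1%:R - 1 <= \sum_(i < m) (i%:R / m%:R : R) ^+ k <=
    m%:R / k.+1%:R.
Proof.
move=> m_gt0; have m_pos : 0 < m%:R :> R by rewrite ltr0n.
have mk_pos : 0 < m%:R ^+ k :> R by rewrite exprn_gt0.
under eq_bigr do rewrite expr_div_n; rewrite -mulr_suml.
have telescope :
    \sum_(i < m) (i.+1%:R ^+ k.+1 - i%:R ^+ k.+1) = m%:R ^+ k.+1 :> R.
  rewrite -(big_mkord xpredT (fun i => i.+1%:R ^+ k.+1 - i%:R ^+ k.+1)).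
  by rewrite (telescope_sumr (fun i => i%:R ^+ k.+1)) // expr0n subr0.
have shift :
    \sum_(i < m) i.+1%:R ^+ k = \sum_(i < m) i%:R ^+ k + m%:R ^+ k :> R.
  rewrite -(big_ord_recr m (fun i => i%:R ^+ k)) big_ord_recl /=.
  by rewrite expr0n gtn_eqF // add0r; apply: eq_bigr.
have lo : k.+1%:R * (\sum_(i < m) i%:R ^+ k) <= m%:R ^+ k.+1 :> R.
  rewrite -telescope mulr_sumr; apply: ler_sum => i _.
  by case/andP: (exp_increment_bounds i).
have hi : m%:R ^+ k.+1 <= k.+1%:R * (\sum_(i < m) i%:R ^+ k + m%:R ^+ k) :> R.
  rewrite -telescope -shift mulr_sumr; apply: ler_sum => i _.
  by case/andP: (exp_increment_bounds i).
have k1_pos : 0 < k.+1%:R :> R by rewrite ltr0n.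
rewrite exprS in lo hi; apply/andP; split.
  rewrite lerBlDr ler_pdivrMr // -(ler_pM2r mk_pos).
  apply: le_trans hi _; rewrite mulrAC mulrDl divfK ?gt_eqF // mul1r.
  by rewrite mulrC.
by rewrite ler_pdivrMr // mulrAC ler_pdivlMr // mulrC.
Qed.

(** A rank in a deck of [m] cards is at most [m]. *)
Lemma rank_second_moment_le m N : (m <= N)%N ->
  \sum_(j < N) rank_law m j * j%:R ^+ 2 <=
    m%:R * \sum_(j < N) rank_law m j * j%:R.
Proof.
move=> le_mN; rewrite mulr_sumr; apply: ler_sum => j _.
have [le_mj|/ltnW le_jm] := leqP m j.
  by rewrite /rank_law !rank_tail_eq0 ?leqW // subr0 !mul0r mulr0.
rewrite expr2 [leRHS]mulrCA ler_wpM2l ?rank_law_ge0 //.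
by rewrite ler_wpM2r ?ler_nat.
Qed.

End MinimumRank.

(** * The law of one step of the procedure *)

Section Step.
Variables (R : realType) (n k : nat).
Implicit Types (D : {set 'I_n}) (x : 'I_n).

Definition rank_in D x : nat := #|[set y in D | (y < x)%N]|.

Lemma min_draw_geq (c : {ffun 'I_k -> 'I_n}) j : (j <= n)%N ->
  (j <= min_draw c)%N = [forall i, (j <= c i)%N].
Proof.
by move=> le_jn; rewrite (big_morph (leq j) (leq_min j) le_jn) big_andE.
Qed.

(** The minimum is at least [j] when all [k] independent draws are. *)
Lemma prob_min_draw_geq D j : (j <= n)%N ->
  \sum_(c : {ffun 'I_k -> 'I_n} | (j <= min_draw c)%N)
      \prod_(i < k) unif_pmf R D (c i) =
    (#|[set y in D | (j <= y)%N]|%:R / #|D|%:R) ^+ k.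
Proof.
move=> le_jn.
transitivity (\sum_(c in ffun_on [pred y : 'I_n | (j <= y)%N])
    \prod_(i < k) unif_pmf R D (c i)).
  by apply: eq_bigl => c; rewrite min_draw_geq.
rewrite -(bigA_distr_big [pred y : 'I_n | (j <= y)%N] (fun=> unif_pmf R D)).
rewrite prodr_const card_ord.
congr (_ ^+ _); rewrite /unif_pmf -big_mkcondr sumr_const mulr_natl.
by congr (_ *+ _); apply: eq_card => y; rewrite !inE unfold_in andbC.
Qed.

(** The event that the minimum is [x] is the difference of two tail events, and
    each tail depends on [D] only through a count of cards. This is where the
    independence of the ranks comes from: the right-hand side sees of the
    deck only its size, which is deterministic. *)
Lemma kcm_stepE D x : x \in D ->
  kcm_step R k D x = rank_law R k #|D| (rank_in D x).
Proof.
move=> xD.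
have split_min : \sum_(c : {ffun 'I_k -> 'I_n} | (x <= min_draw c)%N)
      \prod_(i < k) unif_pmf R D (c i) =
    kcm_step R k D x + \sum_(c : {ffun 'I_k -> 'I_n} | (x.+1 <= min_draw c)%N)
      \prod_(i < k) unif_pmf R D (c i).
  rewrite (bigID (fun c => min_draw c == x)) /=; congr (_ + _).
    apply: eq_bigl => c; rewrite andbC; case: eqP => //= ->; exact: leqnn.
  by apply: eq_bigl => c; rewrite ltn_neqAle andbC eq_sym.
have card_ge : #|[set y in D | (x <= y)%N]| = (#|D| - rank_in D x)%N.
  rewrite -(cardsID [set y : 'I_n | (y < x)%N] D).
  rewrite (_ : #|D :&: _| = rank_in D x); last first.
    by apply: eq_card => y; rewrite !inE.
  by rewrite addKn; apply: eq_card => y; rewrite !inE -leqNgt andbC.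
have card_gt : #|[set y in D | (x < y)%N]| = (#|D| - (rank_in D x).+1)%N.
  rewrite subnS -card_ge.
  rewrite (cardsD1 x [set y in D | (x <= y)%N]) !inE xD leqnn add1n /=.
  apply: eq_card => y; rewrite !inE ltn_neqAle.
  by case: (y \in D) => //=; rewrite ?andbF // eq_sym.
move/eqP: split_min; rewrite -subr_eq eq_sym => /eqP ->.
rewrite (prob_min_draw_geq D (ltn_ord x)).
by rewrite (prob_min_draw_geq D (ltnW (ltn_ord x))) card_ge card_gt.
Qed.

Lemma rank_in_inj D : {in D &, injective (rank_in D)}.
Proof.
have mono (x y : 'I_n) : x \in D -> (x < y)%N -> (rank_in D x < rank_in D y)%N.
  move=> xD lt_xy; apply: proper_card; apply/fintype.properP; split.
    apply/fintype.subsetP => z; rewrite !inE => /andP[-> /ltn_trans]; exact.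
  by exists x; rewrite !inE ?xD ?ltnn.
move=> x y xD yD eq_xy; apply/val_inj/eqP.
case: (ltngtP x y) => // /mono; [move/(_ xD)|move/(_ yD)];
  by rewrite eq_xy ltnn.
Qed.

End Step.

(** * The Lehmer code of a permutation *)

Section Lehmer.
Variable n : nat.
Implicit Type s : {perm 'I_n}.

Lemma rank_in_lt (D : {set 'I_n}) x : x \in D -> (rank_in D x < n)%N.
Proof.
move=> xD; rewrite -[X in (_ < X)%N]card_ord; apply: proper_card.
apply/fintype.properP; split; first exact/fintype.subsetP.
by exists x; rewrite // !inE ltnn andbF.
Qed.

Lemma mem_remaining s t : s t \in remaining s t.
Proof.
rewrite !inE; apply/imsetP => -[u]; rewrite inE => lt_ut /perm_inj eq_tu.
by rewrite eq_tu ltnn in lt_ut.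
Qed.

Lemma card_remaining s t : #|remaining s t| = (n - t)%N.
Proof.
rewrite cardsCs finset.setCK card_ord card_imset; last exact: perm_inj.
congr (_ - _)%N; rewrite cardsE -sum1_card.
by rewrite -(big_ord_widen n (fun=> 1%N)) ?sum1_card ?card_ord // ltnW.
Qed.

Definition lehmer s : {ffun 'I_n -> 'I_n} :=
  [ffun t => Ordinal (rank_in_lt (mem_remaining s t))].

(** If two permutations agree before time [t], they leave the same deck at time
    [t], and in a given deck a card is determined by its rank. *)
Lemma lehmer_inj : injective lehmer.
Proof.
move=> s s' eq_L; apply/permP.
suff agree m (t : 'I_n) : t = m :> nat -> s t = s' t.
  by move=> t; apply: (agree t).
elim/ltn_ind: m t => m IHm t eq_tm.
have eq_D : remaining s t = remaining s' t.
  congr (~: _); apply: eq_in_imset => u; rewrite inE => lt_ut.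
  by apply: (IHm u); rewrite -?eq_tm.
apply: (@rank_in_inj _ (remaining s t)); rewrite ?mem_remaining //.
  by rewrite eq_D mem_remaining.
by move/ffunP/(_ t)/(congr1 val): eq_L; rewrite !ffunE /= eq_D.
Qed.

Lemma inversions_lehmer s : inversions s = (\sum_t lehmer s t)%N.
Proof.
rewrite /inversions -sum1_card.
rewrite (eq_bigl (fun p : 'I_n * 'I_n => (p.1 < p.2)%N && (s p.2 < s p.1)%N));
  last by move=> p; rewrite inE.
rewrite -(pair_big_dep xpredT (fun t u : 'I_n => (t < u)%N && (s u < s t)%N)
  (fun _ _ => 1%N)) /=.
apply: eq_bigr => t _; rewrite sum1_card ffunE /= /rank_in.
rewrite -[LHS](card_imset _ (@perm_inj _ s)); apply: eq_card => y.
rewrite !inE; apply/imsetP/andP => [[u]|[y_rem lt_y]].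
  rewrite unfold_in => /andP[lt_tu lt_su] ->; split=> //.
  apply/imsetP => -[v]; rewrite inE => lt_vt /perm_inj eq_uv.
  by move: lt_tu; rewrite eq_uv ltnNge ltnW.
exists ((s^-1)%g y); rewrite ?permKV // unfold_in permKV lt_y andbT ltnNge.
apply: contra y_rem; rewrite leq_eqVlt => /orP[/eqP/val_inj eq_t|lt_t].
  by move: lt_y; rewrite -eq_t permKV ltnn.
by apply/imsetP; exists ((s^-1)%g y); rewrite ?inE ?permKV.
Qed.

Variables (R : realType) (k : nat).

Lemma kcm_pmf_lehmer s :
  kcm_pmf R k s = \prod_(t < n) rank_law R k (n - t) (lehmer s t).
Proof.
apply: eq_bigr => t _.
by rewrite (kcm_stepE _ _ (mem_remaining s t)) card_remaining ffunE.
Qed.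

(** The codes of permutations give distinct terms of the sum on the right, and the
    other terms are nonnegative. *)
Lemma expect_lehmer_le (G : {ffun 'I_n -> 'I_n} -> R) : (forall f, 0 <= G f) ->
  \sum_s kcm_pmf R k s * G (lehmer s) <=
  \sum_(f : {ffun 'I_n -> 'I_n}) (\prod_(t < n) rank_law R k (n - t) (f t)) * G f.
Proof.
move=> G_ge0; pose w (f : {ffun 'I_n -> 'I_n}) :=
  (\prod_(t < n) rank_law R k (n - t) (f t)) * G f.
have w_ge0 f : 0 <= w f.
  by rewrite mulr_ge0 // prodr_ge0 // => t _; exact: rank_law_ge0.
under eq_bigr do rewrite kcm_pmf_lehmer -/(w _).
rewrite -(big_imset w (in2W lehmer_inj)) /= -[leRHS]/(\sum_f w f).
rewrite [leRHS](bigID (mem (lehmer @: xpredT))) /=.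
by rewrite lerDl sumr_ge0.
Qed.

End Lehmer.

(** * The deviation estimate *)

Section Deviation.
Variables (R : realType).

Lemma sum_remaining_sizes n : \sum_(t < n) (n - t)%:R = n%:R * n.+1%:R / 2 :> R.
Proof.
elim: n => [|n IHn]; first by rewrite big_ord0 !mul0r.
rewrite big_ord_recl /= subn0; under eq_bigr do rewrite /= /bump add1n subSS.
by rewrite IHn -[n.+2]addn2 natrD -natr1; field.
Qed.

(** [M] stands for the mean number of inversions. *)
Lemma mean_deviation_le (k n : nat) (M : R) : (0 < k)%N -> (0 < n)%N ->
  n%:R * n.+1%:R / 2 / k.+1%:R - n%:R <= M <= n%:R * n.+1%:R / 2 / k.+1%:R ->
  `|k%:R / n%:R ^+ 2 * M - 1 / 2| <= k%:R^-1 + k%:R / n%:R.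
Proof.
move=> k_gt0 n_gt0 /andP[lo hi].
have K1 : 1 <= k%:R :> R by rewrite ler1n.
have N1 : 1 <= n%:R :> R by rewrite ler1n.
rewrite -(natr1 k) -(natr1 n) in lo hi.
set K : R := k%:R in K1 lo hi *; set N : R := n%:R in N1 lo hi *.
have K0 : K != 0 by lra.
have N0 : N != 0 by lra.
have K10 : K + 1 != 0 by lra.
(* Since [K / (K + 1) = 1 - v], the scaled upper bound is
   [(1 - v) * (1 + u) / 2], where [v <= K^-1] and [u <= K / N]. *)
pose u := N^-1; pose v := (K + 1)^-1.
have u0 : 0 <= u by rewrite invr_ge0; lra.
have v0 : 0 <= v by rewrite invr_ge0; lra.
have v1 : v <= 1 by rewrite invf_le1; lra.
have vK : v <= K^-1 by rewrite lef_pV2 ?posrE; lra.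
have uK : u <= K / N by rewrite ler_peMl.
have c0 : 0 <= K / N ^+ 2 by rewrite divr_ge0 ?exprn_ge0; lra.
have cE : K / N ^+ 2 * (N * (N + 1) / 2 / (K + 1)) = (1 - v) * (1 + u) / 2.
  by rewrite /u /v; field; rewrite N0.
have {}hi := ler_wpM2l c0 hi; have {}lo := ler_wpM2l c0 lo.
rewrite mulrBr cE (_ : K / N ^+ 2 * N = K / N) in lo; last by field.
rewrite cE in hi; rewrite ler_norml; apply/andP; split; nra.
Qed.

(** Chebyshev's inequality. The term [k / n] bounds the total variance and the
    square bounds the squared bias of the mean. *)
Lemma kcm_deviation_le (n k : nat) (eps : R) :
  (0 < n)%N -> (0 < k)%N -> 0 < eps ->
  kcm_prob R k [set s : {perm 'I_n} |
      eps < `|(inversions s)%:R * (k%:R / n%:R ^+ 2) - 1 / 2|]%SET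
    <= (k%:R / n%:R + (k%:R^-1 + k%:R / n%:R) ^+ 2) / eps ^+ 2.
Proof.
move=> n_gt0 k_gt0 eps_gt0; pose c : R := k%:R / n%:R ^+ 2.
have eps2_gt0 : 0 < eps ^+ 2 by rewrite exprn_gt0.
pose p (t j : 'I_n) : R := rank_law R k (n - t) j.
pose G (f : {ffun 'I_n -> 'I_n}) : R := (\sum_t c * (f t)%:R - 1 / 2) ^+ 2.
have pmf_ge0 s : 0 <= @kcm_pmf R n k s.
  by rewrite kcm_pmf_lehmer prodr_ge0 // => t _; exact: rank_law_ge0.
apply: (@le_trans _ _ ((\sum_s kcm_pmf R k s * G (lehmer s)) / eps ^+ 2)).
  rewrite mulr_suml /kcm_prob big_mkcond /=; apply: ler_sum => s _.
  rewrite inE; case: ifPn => [lt_eps|_]; last first.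
    by rewrite divr_ge0 ?(ltW eps2_gt0) // (mulr_ge0 (pmf_ge0 s)) ?sqr_ge0.
  rewrite -mulrA ler_peMr // ler_pdivlMr // mul1r /G -mulr_sumr -natr_sum.
  rewrite -inversions_lehmer mulrC -[leRHS]real_normK ?num_real //.
  by rewrite lerXn2r ?nnegrE ?normr_ge0 ?ltW.
rewrite ler_pM2r ?invr_gt0 //.
have G_ge0 f : 0 <= G f by exact: sqr_ge0.
apply: le_trans (expect_lehmer_le k G_ge0) _.
have p_sum1 (t : 'I_n) : \sum_j p t j = 1.
  by apply: rank_law_sum1 => //; rewrite subn_gt0 ltn_ord leq_subr.
rewrite (second_moment_sum p_sum1 (fun t j => c * j%:R) (1 / 2)).
pose mu (t : 'I_n) : R := \sum_(j < n) p t j * j%:R.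
have mean_c t : \sum_j p t j * (c * j%:R) = c * mu t.
  by rewrite mulr_sumr; apply: eq_bigr => j _; rewrite mulrCA.
have mu_bounds (t : 'I_n) :
    (n - t)%:R / k.+1%:R - 1 <= mu t <= (n - t)%:R / k.+1%:R.
  rewrite /mu (rank_mean_tail _ k_gt0 (leq_subr t n)).
  by apply: power_mean_bounds; rewrite // subn_gt0.
(* The left summand is the total variance, the right one the squared bias. *)
apply: lerD.
  have var_le (t : 'I_n) :
      \sum_j p t j * (c * j%:R - \sum_l p t l * (c * l%:R)) ^+ 2 <=
      c ^+ 2 * (n%:R ^+ 2 / k%:R).
    apply: le_trans (variance_le_second_moment p_sum1 t _) _.
    under eq_bigr do rewrite exprMn mulrCA.
    rewrite -mulr_sumr ler_wpM2l ?sqr_ge0 //.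
    apply: le_trans (rank_second_moment_le _ k_gt0 (leq_subr t n)) _.
    rewrite expr2 -mulrA ler_pM ?ler_nat ?leq_subr //.
      by rewrite sumr_ge0 // => j _; rewrite mulr_ge0 ?rank_law_ge0.
    case/andP: (mu_bounds t) => _ /le_trans; apply.
    rewrite ler_pM ?invr_ge0 ?ler_nat ?leq_subr //.
    by rewrite lef_pV2 ?posrE ?ltr0n ?ler_nat.
  apply: le_trans (ler_sum _ (fun t _ => var_le t)) _.
  rewrite sumr_const card_ord -mulr_natl /c le_eqVlt; apply/orP; left; apply/eqP.
  by field; rewrite !pnatr_eq0 -!lt0n n_gt0.
under eq_bigr do rewrite mean_c.
rewrite -mulr_sumr -real_normK ?num_real //.
rewrite lerXn2r ?nnegrE ?addr_ge0 ?divr_ge0 ?invr_ge0 //.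
apply: mean_deviation_le => //; rewrite -sum_remaining_sizes mulr_suml.
apply/andP; split; last by apply: ler_sum => t _; case/andP: (mu_bounds t).
rewrite -[X in _ - X%:R]card_ord -sumr_const -sumrB.
by apply: ler_sum => t _; case/andP: (mu_bounds t).
Qed.

End Deviation.

(** * Convergence in probability *)

Theorem theorem3 (R : realType) (k : nat -> nat)
  (k_pos : forall n : nat, (0 < n)%N -> (0 < k n)%N)
  (k_nondecreasing : forall m n : nat, (0 < m)%N -> (m <= n)%N -> (k m <= k n)%N)
  (k_infty : k n @[n --> \oo] --> \oo)
  (k_littleo : (fun n : nat => (k n)%:R : R^o) =o_\oo (fun n : nat => n%:R : R^o)) :
  forall eps : R, 0 < eps ->
    kcm_prob R (k n)
      [set s : {perm 'I_n} |
        eps < `| (inversions s)%:R * ((k n)%:R / n%:R ^+ 2) - 1 / 2 |]%SET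
      @[n --> \oo] --> (0 : R).
Proof.
move=> eps eps_gt0.
have ratio_cvg0 : (k n)%:R / n%:R @[n --> \oo] --> (0 : R).
  apply/cvgr0Pnorm_le => e e_gt0.
  move/eqoP: k_littleo => /(_ e e_gt0) k_small.
  near=> n.
  have n_gt0 : 0 < n%:R :> R by rewrite ltr0n; near: n; exact: nbhs_infty_gt.
  rewrite normf_div ler_pdivrMr ?normr_gt0 ?gt_eqF //.
  by near: n.
have inv_cvg0 : (k n)%:R^-1 @[n --> \oo] --> (0 : R).
  apply/cvgr0Pnorm_le => e e_gt0.
  near=> n.
  have inv_le : e^-1 <= (k n)%:R.
    rewrite (le_trans (ltW (truncnS_gt _))) // ler_nat; near: n.
    move/cvgnyPge: k_infty; exact.
  have k_gt0 : 0 < (k n)%:R :> R by rewrite (lt_le_trans _ inv_le) ?invr_gt0.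
  by rewrite ger0_norm ?invr_ge0 // invf_ple.
have bound_cvg0 :
    ((k n)%:R / n%:R + ((k n)%:R^-1 + (k n)%:R / n%:R) ^+ 2) / eps ^+ 2
      @[n --> \oo] --> (0 : R).
  have sum_cvg0 : (k n)%:R^-1 + (k n)%:R / n%:R @[n --> \oo] --> (0 : R).
    by have := cvgD inv_cvg0 ratio_cvg0; rewrite addr0; apply.
  have sqr_cvg0 : ((k n)%:R^-1 + (k n)%:R / n%:R) ^+ 2 @[n --> \oo] --> (0 : R).
    by have := cvgM sum_cvg0 sum_cvg0; rewrite mulr0; apply.
  have num_cvg0 : (k n)%:R / n%:R + ((k n)%:R^-1 + (k n)%:R / n%:R) ^+ 2
      @[n --> \oo] --> (0 : R).
    by have := cvgD ratio_cvg0 sqr_cvg0; rewrite addr0; apply.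
  have := cvgM num_cvg0 (cvg_cst (eps ^+ 2)^-1).
  by rewrite mul0r; apply.
apply: (squeeze_cvgr _ (cvg_cst 0) bound_cvg0).
near=> n.
have n_gt0 : (0 < n)%N by near: n; exact: nbhs_infty_gt.
rewrite kcm_deviation_le ?k_pos // andbT.
apply: sumr_ge0 => s _; rewrite kcm_pmf_lehmer.
by apply: prodr_ge0 => t _; exact: rank_law_ge0.
Unshelve. all: by end_near.
Qed.
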